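(* For arbitrary $\eta_1,\eta_2>0$ there exists a sequence $(z_n)$ of distinct numbers in $\mathbb{D}$ with the following properties: (i) $\exists C>0$ such that $n_{z_k}\Bigl(\frac{1-|z_k|}{2}\Bigr)\le C\log^{\eta_1}\frac{1}{1-|z_k|}$ for all $k\in\mathbb{N}$; (ii) $\exists C>0$ such that $N_{z_k}\Bigl(\frac{1-|z_k|}{2}\Bigr)\le C\log^{1+\eta_1+\eta_2}\frac{1}{1-|z_k|}$ for all $k\in\mathbb{N}$; (iii) for every $\eta<\eta_2$, $(z_k)$ cannot be the zero sequence of a solution $f$ of an equation $f''+a(z)f=0$ where $a$ is analytic in $\mathbb{D}$ with $\log M(r,a)=O\bigl(\log^{1+\eta}\frac{1}{1-r}\bigr)$ as $r\to1-$.
   Context: $\mathbb{D}=\{z\in\mathbb{C}:|z|<1\}$. For $a$ analytic in $\mathbb{D}$ and $r\in(0,1)$, $M(r,a)=\max\{|a(z)|:|z|=r\}$. Here $\log^{p}x=(\log x)^p$. Being the zero sequence of $f$ means that $f$ is analytic in $\mathbb{D}$ with zeros precisely at the points $z_k$. For the sequence $(z_k)$ and $\zeta\in\mathbb{D}$, $n_\zeta(t)=\sum_{|z_k-\zeta|\le t}1$ is the number of members of the sequence with $|z_k-\zeta|\le t$, and $$N_\zeta(r)=\int_0^r\frac{(n_\zeta(t)-1)^+}{t}\,dt,\qquad x^+=\max\{x,0\}.$$ *)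

(* Defs.v *)
From HB Require Import structures.
From mathcomp Require Import all_boot all_order all_algebra.
From mathcomp Require Import complex.
From mathcomp Require Import all_classical all_reals all_analysis.

Set Implicit Arguments.
Unset Strict Implicit.
Unset Printing Implicit Defensive.

Import Order.TTheory GRing.Theory Num.Theory.
Import numFieldNormedType.Exports.

Local Open Scope classical_set_scope.
Local Open Scope complex_scope.
Local Open Scope ring_scope.

(* The library norm of R[i] is itself R[i]-valued; this is the R-valued one. *)
Definition cmod {R : realType} (z : R[i]) : R := ComplexField.Normc.normc z.

Definition unit_disc {R : realType} : set R[i] := [set z | cmod z < 1].

(* [derive1] and [derivable _ _ 1] need a normed module over the scalar field.
   Taking R[i]^o, i.e. R[i] over itself, makes these the complex derivative and
   complex differentiability. *)
Definition analytic_on {R : realType} (D : set R[i]) (f : R[i] -> R[i]) : Prop :=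
  forall z, D z -> derivable (f : R[i]^o -> R[i]^o) z 1.

Definition cderive {R : realType} (f : R[i] -> R[i]) : R[i] -> R[i] :=
  derive1 (f : R[i]^o -> R[i]^o).

(* [derive1] is total; asking that f and f' be differentiable ensures that
   [cderive (cderive f)] is the actual second derivative. *)
Definition ode_solution_on {R : realType} (D : set R[i]) (a f : R[i] -> R[i]) :
    Prop :=
  [/\ analytic_on D f, analytic_on D (cderive f) &
      forall z, D z -> cderive (cderive f) z + a z * f z = 0].

(* For a continuous on the circle |z| = r the supremum is a maximum. *)
Definition max_modulus {R : realType} (r : R) (a : R[i] -> R[i]) : R :=
  sup [set cmod (a z) | z in [set z | cmod z = r]].

Definition zero_sequence_of {R : realType} (D : set R[i]) (z : nat -> R[i])
    (f : R[i] -> R[i]) : Prop :=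
  analytic_on D f /\ [set w | D w /\ f w = 0] = range z.

(* Members of the sequence are counted by index; the value is +oo when
   infinitely many of them lie in the closed disc. *)
Definition npoints {R : realType} (z : nat -> R[i]) (zeta : R[i]) (t : R) :
    \bar R :=
  counting [set k | cmod (z k - zeta) <= t].

Definition Npoints {R : realType} (z : nat -> R[i]) (zeta : R[i]) (r : R) :
    \bar R :=
  (\int[lebesgue_measure]_(t in `]0%R, r])
     (maxe (npoints z zeta t - 1) 0 * (t^-1)%:E))%E.

Definition log_dist {R : realType} (r : R) : R := ln (1 / (1 - r)).

(* Main.v *)
Require Import Defs.
From HB Require Import structures.
From mathcomp Require Import all_boot all_order all_algebra.
From mathcomp Require Import complex.
From mathcomp Require Import all_classical all_reals all_analysis.
From mathcomp Require Import ring lra zify.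

Import Order.TTheory GRing.Theory Num.Theory.
Import numFieldNormedType.Exports.

Local Open Scope classical_set_scope.
Local Open Scope complex_scope.
Local Open Scope ring_scope.

(** The sequence consists of pairs of real points [1 - delta_k] and
    [1 - delta_k + g_k], where [delta_k = exp (- 2 (k + 1))] (below, [depth k])
    and [g_k = delta_k / 8 * exp (- (k + 1) ^ (1 + eta2))] (below, [gap k]).
    Different pairs are so far apart that a disc of (i) sees only one pair, so
    [n <= 2] and [N] is the logarithm of the ratio of the radius and [g_k], of
    order [(k + 1) ^ (1 + eta2)].

    If [f'' + a f = 0] and [f] vanishes at both ends of a real segment of length
    [g] on which [|a| <= M], Rolle's theorem gives a zero of the derivative of
    [Re f], and two applications of the mean value inequality give
    [|Re f| <= M g^2 W], where [W] is the maximum of [|Re f| + |Im f|]; the same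
    holds for [Im f]. Hence [W <= 2 M g^2 W], and [f] vanishes on the whole
    segment if [M g^2 < 1/2]. When [log M = O(log^(1 + eta) (1 / (1 - r)))] with
    [eta < eta2] this happens for all large [k], although [f] has only two zeros
    on the segment. *)

(** * Real-valued modulus and complex derivatives along the real axis *)

Section Complex.
Context {R : realType}.
Implicit Types (z w : R[i]) (x t : R).

Lemma normE_cmod z : `|z| = (cmod z)%:C.
Proof. by []. Qed.

Lemma cmod_ge0 z : 0 <= cmod z.
Proof. by case: z => a b; rewrite /cmod /= sqrtr_ge0. Qed.

Lemma cmod0 : cmod 0 = 0 :> R.
Proof. exact: ComplexField.Normc.normc0. Qed.

Lemma cmod_real x : cmod x%:C = `|x|.
Proof. by rewrite /cmod /= expr0n addr0 sqrtr_sqr. Qed.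

Lemma cmodN z : cmod (- z) = cmod z.
Proof. by apply: complexI; rewrite -!normE_cmod normrN. Qed.

Lemma cmodBC z w : cmod (z - w) = cmod (w - z).
Proof. by rewrite -cmodN opprB. Qed.

Lemma Re_le_cmod z : `|complex.Re z| <= cmod z.
Proof. by have := normc_ge_Re z; rewrite normE_cmod lecR. Qed.

Lemma Im_le_cmod z : `|complex.Im z| <= cmod z.
Proof.
by case: z => a b; rewrite /cmod/= -sqrtr_sqr ler_wsqrtr// lerDr sqr_ge0.
Qed.

Lemma cmod_le_ReIm z : cmod z <= `|complex.Re z| + `|complex.Im z|.
Proof.
case: z => a b; rewrite /cmod/= -(@ler_pXn2r _ 2) ?nnegrE ?addr_ge0//.
rewrite sqr_sqrtr ?addr_ge0 ?sqr_ge0// sqrrD !real_normK ?num_real//.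
by rewrite addrAC lerDl mulrn_wge0 // mulr_ge0.
Qed.

(** A positive radius in [R[i]] has zero imaginary part, so neighbourhoods can be described with
    real radii. *)
Lemma continuous_cmodP (f : R[i]^o -> R[i]^o) z : {for z, continuous f} ->
  forall e : R, 0 < e -> exists2 d : R, 0 < d &
    forall w, cmod (w - z) < d -> cmod (f w - f z) < e.
Proof.
move=> /cvgrPdist_lt cf e e0.
have /cf : 0 < e%:C by rewrite ltcR.
move=> /nbhs_ballP[[d d'] /=]; rewrite ltcE/= => /andP[/eqP -> d0] H.
exists d => // w wz; rewrite cmodBC -ltcR; apply: (H w).
rewrite -ball_normE /=; suff : (cmod (z - w))%:C < d%:C by [].
by rewrite ltcR cmodBC.
Qed.

Lemma derivable_cmodP (f : R[i]^o -> R[i]^o) z : derivable f z 1 ->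
  forall e : R, 0 < e -> exists2 d : R, 0 < d &
    forall h, h != 0 -> cmod h < d ->
      cmod (h^-1 * (f (h + z) - f z) - cderive f z) < e.
Proof.
rewrite /cderive derive1E /derivable => fz.
have /cvgrPdist_lt := fz; rewrite -/('D_1 f z) => cf e e0.
have /cf : 0 < e%:C by rewrite ltcR.
rewrite near_withinE => /nbhs_ballP[[d d'] /=].
rewrite ltcE/= => /andP[/eqP -> d0] H.
exists d => // h h0 hd; rewrite cmodBC -ltcR.
have := H h; rewrite /GRing.scale/= mulr1; apply => //.
rewrite -ball_normE /=; suff : (cmod (0 - h))%:C < d%:C by [].
by rewrite ltcR sub0r cmodN.
Qed.

(** Meant for [F] the real or the imaginary part: real linearity carries [F] through difference
    quotients with real increments, and domination by the modulus controls the error. *)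
Lemma is_derive_along_reals (F : R[i] -> R) (f : R[i] -> R[i]) x :
  {morph F : z w / z - w} -> (forall t z, F (t%:C * z) = t * F z) ->
  (forall z, `|F z| <= cmod z) ->
  derivable (f : R[i]^o -> R[i]^o) x%:C 1 ->
  is_derive (x : R) 1 (fun t : R => F (f t%:C) : R) (F (cderive f x%:C)).
Proof.
move=> FB FZ Fle df.
suff H : (fun h : R => h^-1 *: (F (f (h *: 1 + x)%:C) - F (f x%:C))) @ 0^' -->
    F (cderive f x%:C).
  apply: DeriveDef; first by apply/cvg_ex; eexists; exact: H.
  exact: (cvg_lim _ H).
apply/cvgrPdist_lt => e e0.
have [d d0 H] := derivable_cmodP _ _ df e e0.
rewrite near_withinE; apply/nbhs_ballP; exists d => //= h.
rewrite -ball_normE /= sub0r normrN => hd h0.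
rewrite distrC; apply: le_lt_trans (H h%:C _ _).
- rewrite -FB -[_ *: F _]FZ -FB; apply: le_trans (Fle _) _.
  by rewrite -fmorphV rmorphD /= /GRing.scale/= mulr1.
- by rewrite fmorph_eq0.
- by rewrite cmod_real.
Qed.

End Complex.

(** * Solutions with two close real zeros *)

Section ODE.
Context {R : realType}.
Implicit Types (u v g : R -> R) (p q x y K M : R) (a f : R[i] -> R[i]).

Lemma is_derive_within_continuous {g} g1 {p q} :
  (forall x, x \in `[p, q] -> is_derive (x : R) 1 g (g1 x)) ->
  {within `[p, q], continuous g}.
Proof.
by move=> dg; apply: derivable_within_continuous => x /dg [].
Qed.

Lemma derive_le_dist g g1 p q K :
  (forall x, x \in `[p, q] -> is_derive (x : R) 1 g (g1 x)) ->
  (forall x, x \in `[p, q] -> `|g1 x| <= K) ->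
  forall x y, x \in `[p, q] -> y \in `[p, q] -> `|g y - g x| <= K * (q - p).
Proof.
move=> dg bg x y; wlog xy : x y / x <= y => [hw xpq ypq|].
  by have [/hw|/ltW /hw] := leP x y; rewrite 1?distrC; apply.
rewrite !in_itv/= => /andP[px xq] /andP[py yq].
have sub z : z \in `[x, y] -> z \in `[p, q].
  by rewrite !in_itv/= => /andP[xz zy]; rewrite (le_trans px)//= (le_trans zy).
have dxy z : z \in `[x, y] -> is_derive (z : R) 1 g (g1 z) by move=> /sub /dg.
have cg := is_derive_within_continuous g1 dxy.
have doo z : z \in `]x, y[ -> is_derive (z : R) 1 g (g1 z).
  by move=> /subset_itv_oo_cc; exact: dxy.
have [c cxy ->] := MVT_segment xy doo cg.
have cK := bg c (sub c cxy).
rewrite normrM (ger0_norm (_ : 0 <= y - x)) ?subr_ge0//.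
by apply: ler_pM => //; rewrite ?subr_ge0// lerB.
Qed.

(** One factor [q - p] comes from the mean value inequality for [u1] starting at its Rolle zero, the
    other from that for [u] starting at [p]. *)
Lemma two_zeros_bound {u} u1 u2 {p q} K : p < q ->
  (forall x, x \in `[p, q] -> is_derive (x : R) 1 u (u1 x)) ->
  (forall x, x \in `[p, q] -> is_derive (x : R) 1 u1 (u2 x)) ->
  u p = 0 -> u q = 0 -> (forall x, x \in `[p, q] -> `|u2 x| <= K) ->
  forall x, x \in `[p, q] -> `|u x| <= K * (q - p) ^+ 2.
Proof.
move=> pq du du1 up uq u2K x xpq.
have ppq : p \in `[p, q] by rewrite in_itv/= lexx ltW.
have cu := is_derive_within_continuous u1 du.
have dou z : z \in `]p, q[ -> derivable u z 1.
  by move=> /subset_itv_oo_cc /du [].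
have upq : u p = u q by rewrite up uq.
have [c cpq u1c] := Rolle pq dou cu upq.
have {cpq}cpq : c \in `[p, q] by exact: subset_itv_oo_cc.
have {}u1c : u1 c = 0.
  by have [_ <-] := du _ cpq; have [_] := u1c.
have u1K y : y \in `[p, q] -> `|u1 y| <= K * (q - p).
  by move=> ypq; rewrite -[u1 y]subr0 -u1c;
    exact: (derive_le_dist _ _ _ _ _ du1 u2K).
rewrite expr2 mulrA -[u x]subr0 -up.
exact: (derive_le_dist _ _ _ _ _ du u1K).
Qed.

(** Rolle's theorem fails for complex-valued functions, so the real and imaginary parts are bounded
    separately, each with its own Rolle point. Their sum [W] closes the estimate because it
    dominates the modulus of [f]. *)
Lemma ode_solution_eq0_between a f p q M :
  ode_solution_on unit_disc a f -> 0 <= p -> p < q -> q < 1 ->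
  f p%:C = 0 -> f q%:C = 0 ->
  (forall x, x \in `[p, q] -> cmod (a x%:C) <= M) -> M * (q - p) ^+ 2 < 2^-1 ->
  forall x, x \in `[p, q] -> f x%:C = 0.
Proof.
move=> [af adf ode] p0 pq q1 fp fq aM Msmall.
have disc x : x \in `[p, q] -> unit_disc x%:C.
  rewrite in_itv/= => /andP[px xq]; rewrite /unit_disc /mkset cmod_real.
  by rewrite ger0_norm ?(le_lt_trans xq)// (le_trans p0).
pose W (x : R) := `|complex.Re (f x%:C)| + `|complex.Im (f x%:C)|.
have FW (F : R[i] -> R) :
    {morph F : z w / z - w} -> (forall t z, F (t%:C * z) = t * F z) ->
    (forall z, `|F z| <= cmod z) ->
    {within `[p, q], continuous (fun x : R => F (f x%:C) : R)} /\
    forall K, (forall x, x \in `[p, q] -> W x <= K) ->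
    forall x, x \in `[p, q] -> `|F (f x%:C)| <= M * K * (q - p) ^+ 2.
  move=> FB FZ Fle.
  have F0 : F 0 = 0 by rewrite -[0](subrr 0) FB subrr.
  have d0 x : x \in `[p, q] -> is_derive (x : R) 1 (fun t : R => F (f t%:C) : R)
      (F (cderive f x%:C)).
    by move=> /disc /af; exact: is_derive_along_reals.
  have d1 x : x \in `[p, q] -> is_derive (x : R) 1
      (fun t : R => F (cderive f t%:C) : R) (F (cderive (cderive f) x%:C)).
    by move=> /disc /adf; exact: is_derive_along_reals.
  split; first exact: (is_derive_within_continuous _ d0).
  move=> K WK; apply: (two_zeros_bound _ _ _ pq d0 d1); rewrite ?fp ?fq ?F0//.
  move=> x xpq; apply: le_trans (Fle _) _.
  have /eqP := ode _ (disc _ xpq); rewrite addr_eq0 => /eqP ->.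
  rewrite cmodN [cmod _]ComplexField.Normc.normcM ler_pM ?cmod_ge0 ?aM//.
  exact: le_trans (cmod_le_ReIm _) (WK _ xpq).
have [||cu bu] := FW (@complex.Re R) _ _ (@Re_le_cmod R).
  by move=> [b c] [d e].
  by move=> t [b c]; rewrite /= mul0r subr0.
have [||cv bv] := FW (@complex.Im R) _ _ (@Im_le_cmod R).
  by move=> [b c] [d e].
  by move=> t [b c]; rewrite /= mul0r addr0.
have cW : {within `[p, q], continuous W}.
  by move=> x; apply: cvgD; apply: cvg_norm; [exact: cu|exact: cv].
have [x0 x0pq maxW] := EVT_max (ltW pq) cW.
have := lerD (bu _ maxW _ x0pq) (bv _ maxW _ x0pq).
rewrite -[X in X <= _ -> _]/(W x0) => W0.
(* If [W x0] were positive, [Msmall] would make the right side of [W0], twice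
   [M * W x0 * (q - p) ^+ 2], smaller than [W x0]. *)
have {W0}W0 : W x0 <= 0.
  rewrite leNgt; apply/negP => Wpos.
  by move: Msmall; rewrite -(ltr_pM2l Wpos) => Ms; lra.
move=> x xpq; apply: ComplexField.Normc.eq0_normc; apply/eqP.
rewrite eq_le cmod_ge0 andbT.
exact: le_trans (cmod_le_ReIm _) (le_trans (maxW _ xpq) W0).
Qed.

End ODE.

(** * Pointwise bounds from the maximum modulus *)

Section Max.
Context {R : realType}.
Implicit Types (a : R[i] -> R[i]) (z w : R[i]).

Lemma ler_cmod_dist z w : `|cmod z - cmod w| <= cmod (z - w).
Proof.
by have := ler_dist_dist z w; rewrite !normE_cmod -rmorphB cmod_real lecR.
Qed.

Lemma analytic_on_continuous D a z : analytic_on D a -> D z ->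
  {for z, continuous (a : R[i]^o -> R[i]^o)}.
Proof. by move=> aD /aD /derivable1_diffP /differentiable_continuous. Qed.

(** Pulls the modulus back along a curve, so that the extreme value theorem on real intervals
    applies to arcs. *)
Lemma continuous_cmod_comp {D a} {u v : R -> R} {x : R} :
  analytic_on D a -> D (u x +i* v x) ->
  {for x, continuous u} -> {for x, continuous v} ->
  {for x, continuous (fun t => cmod (a (u t +i* v t)))}.
Proof.
move=> aD Dx /cvgrPdist_lt cu /cvgrPdist_lt cv.
have ca := continuous_cmodP _ _ (analytic_on_continuous _ _ _ aD Dx).
apply/cvgrPdist_lt => e e0; have [d d0 H] := ca e e0.
have d20 : 0 < d / 2 by rewrite divr_gt0.
near=> t; apply: le_lt_trans (ler_cmod_dist _ _) _; rewrite cmodBC; apply: H.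
apply: le_lt_trans (cmod_le_ReIm _) _ => /=; rewrite [d]splitr distrC.
rewrite (distrC (v t)); apply: ltrD; near: t; [exact: cu|exact: cv].
Unshelve. all: by end_near. Qed.

(** The point is that the values on the circle are bounded above; otherwise [sup] would be a mere
    default value. *)
Lemma cmod_le_max_modulus {a} z : analytic_on unit_disc a -> unit_disc z ->
  cmod (a z) <= max_modulus (cmod z) a.
Proof.
move=> aD z1; set r := cmod z.
have r0 : 0 <= r by exact: cmod_ge0.
pose h (x : R) := Num.sqrt (r ^+ 2 - x ^+ 2).
(* The circle is the union of the arcs [x + i s sqrt (r^2 - x^2)] for [s = 1]
   and [s = -1]. *)
have arc (s : R) : s ^+ 2 = 1 -> exists B, forall x, x \in `[- r, r] ->
    cmod (a (x +i* (s * h x))) <= B.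
  move=> s1; have cg : {within `[- r, r], continuous
      (fun x : R => cmod (a (x +i* (s * h x))))}.
    apply: continuous_in_subspaceT => x.
    rewrite inE /= in_itv/= => /andP[rx xr].
    apply: (@continuous_cmod_comp unit_disc a id (fun t => s * h t) x aD).
    - rewrite /unit_disc /cmod /= exprMn s1 mul1r sqr_sqrtr.
        by rewrite addrC subrK sqrtr_sqr ger0_norm.
      rewrite subr_ge0 -ler_sqrt ?sqr_ge0// !sqrtr_sqr (ger0_norm r0).
      by rewrite ler_norml rx.
    - exact: cvg_id.
    - apply: cvgM; first exact: cvg_cst.
      apply: continuous_comp; last exact: sqrt_continuous.
      by apply: cvgB; [exact: cvg_cst|exact: exprn_continuous].
  have [|c _ H] := EVT_max _ cg; first by rewrite ge0_cp.
  by exists (cmod (a (c +i* (s * h c)))).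
have [B1 H1] := arc 1 (expr1n _ _).
have [B2 H2] : exists B, forall x, x \in `[- r, r] ->
    cmod (a (x +i* (-1 * h x))) <= B by apply: arc; rewrite sqrrN expr1n.
apply: ub_le_sup; last by exists z.
exists (Num.max B1 B2) => _ [[x y] /= xyr <-]; rewrite le_max.
have xr : x \in `[- r, r].
  by rewrite in_itv /= -ler_norml -xyr; exact: (Re_le_cmod (x +i* y)).
(* The sign of [y] then decides which arc contains the point. *)
have hx : h x = `|y|.
  rewrite /h -xyr /cmod/= sqr_sqrtr ?addr_ge0 ?sqr_ge0//.
  by rewrite addrAC subrr add0r sqrtr_sqr.
have := H1 x xr; have := H2 x xr; rewrite hx mul1r mulN1r.
by have [y0|y0] := ler0P y; rewrite ?opprK => h2 h1; rewrite ?h1 ?h2 ?orbT.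
Qed.

End Max.

(** * Counting functions around an isolated pair *)

Section Npoints.
Context {R : realType}.

Lemma counting_set1 (n : nat) : counting [set n] = 1%:E :> \bar R.
Proof.
rewrite /counting; case: asboolP => [_|[]//].
by rewrite fset_set1 finmap.cardfs1.
Qed.

Lemma counting_set2 (m n : nat) : m != n ->
  counting [set m; n] = 2%:E :> \bar R.
Proof.
move=> mn; rewrite /counting; case: asboolP => [_|[]]; last first.
  by rewrite finite_setU.
by rewrite fset_setU// !fset_set1 finmap.cardfs2 mn.
Qed.

(** Below [g] only one point is counted and the integrand vanishes, which removes the singularity at
    0; from [g] on it is [1/t], with primitive [ln]. *)
Lemma Npoints_pair (z : nat -> R[i]) zeta (g r : R) : 0 < g -> g < r ->
  (forall t, 0 < t -> t < g -> npoints z zeta t = 1%:E) ->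
  (forall t, g <= t -> t <= r -> npoints z zeta t = 2%:E) ->
  Npoints z zeta r = (ln r - ln g)%:E.
Proof.
move=> g0 gr n1 n2; rewrite /Npoints.
transitivity (\int[lebesgue_measure]_(t in `]0%R, r])
    ((fun t : R => (t^-1)%:E) \_ `[g, r]) t)%E.
  apply: eq_integral.
  move=> t; rewrite inE/= in_itv/= => /andP[t0 tr]; rewrite patchE.
  have [tg|gt] := ltP t g.
    by rewrite n1// subee// maxxx mul0e memNset//= in_itv/= leNgt tg.
  rewrite n2// mem_set/= ?in_itv/= ?gt// -EFinB (_ : 2 - 1 = 1); last by lra.
  by rewrite max_l ?lee_fin// mul1e.
rewrite -integral_mkcondr (_ : _ `&` _ = [set` `[g, r]]); last first.
  apply/seteqP; split=> t /=; rewrite !in_itv/=; first by case.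
  by move=> /andP[gt tr]; rewrite gt tr (lt_le_trans g0 gt).
have gt0 t : t \in `[g, r] -> 0 < t.
  by rewrite in_itv/= => /andP[gt _]; exact: lt_le_trans gt.
rewrite (@continuous_FTC2 _ _ (@ln R))//.
- apply: continuous_in_subspaceT => t; rewrite inE/= => /gt0 t0.
  by apply: inv_continuous; rewrite gt_eqF.
- split.
  + by move=> t /subset_itv_oo_cc /gt0 t0; have [] := is_derive1_ln t0.
  + by apply: cvg_at_right_filter; exact: continuous_ln.
  + by apply: cvg_at_left_filter; apply: continuous_ln; exact: lt_trans gr.
- move=> t /subset_itv_oo_cc /gt0 t0; rewrite derive1E.
  by have [_] := is_derive1_ln t0.
Qed.

End Npoints.

Local Arguments cmod : simpl never.

Lemma powR_ge1 {R : realType} (a x : R) : 1 <= a -> 0 <= x -> 1 <= a `^ x.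
Proof. by move=> a1 x0; rewrite -(powRr0 a) ler_powR. Qed.

(** * The sequence of pairs; the exponent [s] will be [1 + eta2] *)

Section Pairs.
Context {R : realType}.
Variable s : R.
Implicit Types (k n : nat) (t : R).

Definition depth k : R := expR (- (2 * k.+1%:R)).

Definition gap k : R := depth k / 8 * expR (- (k.+1%:R `^ s)).

(* [1 - |z_n|]; the indices [2 k] and [2 k + 1] form the [k]-th pair. *)
Definition height n : R := depth n./2 - (if odd n then gap n./2 else 0).

Definition pair_seq n : R[i] := (1 - height n)%:C.

Lemma depth_gt0 k : 0 < depth k.
Proof. exact: expR_gt0. Qed.

(** Successive depths have ratio [exp (-2)], and [exp 1 >= 2]. *)
Lemma depth_ltn j k : (j < k)%N -> depth k <= depth j / 4.
Proof.
move=> jk; have e2 : 2 <= expR 1 :> R by have := expR_ge1Dx (1 : R).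
rewrite ler_pdivlMr//; apply: (@le_trans _ _ (depth k * (expR 1 * expR 1))).
  by rewrite ler_pM2l ?depth_gt0//; nra.
rewrite /depth -!expRD ler_expR.
have : (j.+1 + 1)%:R <= k.+1%:R :> R by rewrite ler_nat; lia.
by rewrite natrD; lra.
Qed.

Lemma depth_le_third k : depth k <= 1 / 3.
Proof.
rewrite /depth expRN div1r lef_pV2 ?posrE ?expR_gt0//.
have := expR_ge1Dx (2 * k.+1%:R : R).
have : 1 <= k.+1%:R :> R by rewrite ler1n.
lra.
Qed.

Lemma gap_gt0 k : 0 < gap k.
Proof. by rewrite /gap mulr_gt0 ?expR_gt0 ?divr_gt0 ?depth_gt0. Qed.

Lemma gap_le k : gap k <= depth k / 8.
Proof.
by rewrite /gap ger_pMr ?expR_le1 ?oppr_le0 ?powR_ge0 ?divr_gt0 ?depth_gt0.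
Qed.

Lemma height_bounds n : depth n./2 * (7 / 8) <= height n <= depth n./2.
Proof.
have := gap_gt0 n./2; have := gap_le n./2; rewrite /height.
by case: (odd n) => h1 h2; apply/andP; split; have := depth_gt0 n./2; lra.
Qed.

Lemma height_gt0 n : 0 < height n.
Proof. by have /andP[] := height_bounds n; have := depth_gt0 n./2; lra. Qed.

Lemma height_lt1 n : height n < 1.
Proof.
by have /andP[] := height_bounds n; have := depth_le_third n./2; lra.
Qed.

Lemma cmod_pair_seq n : cmod (pair_seq n) = 1 - height n.
Proof. by rewrite cmod_real ger0_norm// subr_ge0 ltW// height_lt1. Qed.

Lemma cmod_pair_seqB k n :
  cmod (pair_seq k - pair_seq n) = `|height k - height n|.
Proof.
have -> : pair_seq k - pair_seq n = (height n - height k)%:C.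
  by rewrite /pair_seq -rmorphB; congr (_%:C); lra.
by rewrite cmod_real distrC.
Qed.

Lemma height_partner k n : k./2 = n./2 -> k <> n ->
  `|height k - height n| = gap n./2.
Proof.
move=> kn nkn; have okn : odd k = ~~ odd n.
  have := odd_double_half k; have := odd_double_half n; rewrite kn.
  by case: (odd k) (odd n) => -[]// h1 h2; case: nkn; rewrite -h1 -h2.
rewrite /height kn okn; have g0 := gap_gt0 n./2.
by case: (odd n) => /=; [rewrite ger0_norm|rewrite ler0_norm]; lra.
Qed.

(** Depths of different pairs differ by a factor of at least 4, while a height loses at most an
    eighth of its depth. Hence the discs of (i) and (ii) reach no other pair. *)
Lemma height_far k n : k./2 <> n./2 -> height n / 2 < `|height k - height n|.
Proof.
move=> /eqP; rewrite neq_ltn => /orP[] /depth_ltn d;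
  have /andP[] := height_bounds k; have /andP[] := height_bounds n;
  have := depth_gt0 n./2; have := depth_gt0 k./2; move: d;
  move: (height k) (height n) (depth k./2) (depth n./2) => x y u v *.
- by rewrite gtr0_norm; lra.
- by rewrite ltr0_norm; lra.
Qed.

Lemma gap_lt_height n : gap n./2 < height n / 2.
Proof.
by have /andP[] := height_bounds n; have := gap_le n./2;
  have := depth_gt0 n./2; lra.
Qed.

Lemma pair_seq_inj : injective pair_seq.
Proof.
move=> k n /eqP; rewrite -subr_eq0 => /eqP kn; apply/eqP/negPn/negP => /eqP nkn.
have := cmod_pair_seqB k n; rewrite kn cmod0.
have [/height_partner/(_ nkn) ->|/eqP /height_far] := eqVneq k./2 n./2.
  by have := gap_gt0 n./2; lra.
by have := height_gt0 n; lra.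
Qed.

Lemma npoints_lt_gap n t : 0 <= t -> t < gap n./2 ->
  npoints pair_seq (pair_seq n) t = 1%:E.
Proof.
move=> t0 tg; rewrite -(counting_set1 n); congr counting.
apply/seteqP; split=> k /=; last first.
  by move=> ->; rewrite cmod_pair_seqB subrr normr0.
rewrite cmod_pair_seqB => kt; apply: contrapT => nkn; move: kt.
have [/height_partner/(_ nkn) ->|/eqP /height_far] := eqVneq k./2 n./2.
  by lra.
by have := gap_lt_height n; lra.
Qed.

Lemma npoints_ge_gap n t : gap n./2 <= t -> t <= height n / 2 ->
  npoints pair_seq (pair_seq n) t = 2%:E.
Proof.
(* [p] is the other index of the pair of [n]: same half, opposite parity. *)
move=> gt th; pose p := (~~ odd n + (n./2).*2)%N.
have n2 : n = (odd n + (n./2).*2)%N by rewrite odd_double_half.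
have pn : p <> n by rewrite /p {3}n2; case: odd; lia.
have ph : p./2 = n./2 by rewrite /p half_bit_double.
rewrite -(counting_set2 p n); last exact/eqP.
congr counting; apply/seteqP; split=> k /=; rewrite cmod_pair_seqB; last first.
  case=> ->; first by rewrite height_partner.
  by rewrite subrr normr0 (le_trans _ gt)// ltW// gap_gt0.
move=> kt; have kh : k./2 = n./2.
  by apply/eqP/negPn/negP => /eqP /height_far; lra.
have k2 := odd_double_half k; rewrite kh in k2.
have [okn|] := eqVneq (odd k) (odd n); first by right; rewrite -k2 okn -n2.
by move=> okn; left; rewrite -k2 /p; move: okn; case: odd; case: odd.
Qed.

Lemma Npoints_pair_seq n :
  Npoints pair_seq (pair_seq n) (height n / 2) =
  (ln (height n / 2) - ln (gap n./2))%:E.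
Proof.
apply: Npoints_pair; [exact: gap_gt0|exact: gap_lt_height| |].
- by move=> t /ltW; exact: npoints_lt_gap.
- exact: npoints_ge_gap.
Qed.

Lemma log_dist_bounds n :
  2 * n./2.+1%:R <= log_dist (1 - height n) <= 2 * n./2.+1%:R + 1.
Proof.
rewrite /log_dist subKr div1r lnV ?posrE ?height_gt0//.
have /andP[h1 h2] := height_bounds n; have d0 := depth_gt0 n./2.
have ld : ln (depth n./2) = - (2 * n./2.+1%:R) by rewrite /depth expRK.
apply/andP; split.
  by rewrite -[leLHS]opprK lerN2 -ld ler_ln ?posrE ?height_gt0.
rewrite lerNl opprD -ld.
(* The slack 1 in the upper bound absorbs the factor 7/8 of [height_bounds], as
   [exp (-1) <= 7/8]. *)
have -> : -1 = ln (expR (-1)) :> R by rewrite expRK.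
rewrite -lnM ?posrE ?expR_gt0// ler_ln ?posrE ?height_gt0 ?mulr_gt0 ?expR_gt0//.
apply: le_trans h1; rewrite ler_pM2l// expRN -[leRHS]invrK.
rewrite lef_pV2 ?posrE ?expR_gt0//.
by have := expR_ge1Dx (1 : R); rewrite invf_div; lra.
Qed.

(** The difference of logarithms is at most [ln 4] plus the power; since [ln 4 <= 3] and the power
    is at least 1, the factor 4 suffices. *)
Lemma Npoints_pair_seq_le n : 0 <= s ->
  (Npoints pair_seq (pair_seq n) (height n / 2) <= (4 * n./2.+1%:R `^ s)%:E)%E.
Proof.
move=> s0; rewrite Npoints_pair_seq lee_fin /gap.
have d0 := depth_gt0 n./2; have h0 := height_gt0 n.
rewrite [ln (_ * expR _)]lnM ?posrE ?expR_gt0 ?divr_gt0// expRK.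
have -> : ln (depth n./2 / 8) = ln (depth n./2 / 2) - ln 4.
  by rewrite -ln_div ?posrE ?divr_gt0//; congr ln; lra.
have : ln (height n / 2) <= ln (depth n./2 / 2).
  rewrite ler_ln ?posrE ?divr_gt0//; have /andP[_] := height_bounds n; lra.
have : ln 4 <= 3 :> R.
  by have := @le_ln1Dx R 3; rewrite (_ : 1 + 3 = 4); [apply|]; lra.
have : 1 <= n./2.+1%:R `^ s by rewrite powR_ge1 ?ler1n.
lra.
Qed.

(** * The growth bound excludes the sequence as a zero sequence *)

Lemma log_dist_le (x y : R) : x <= y -> y < 1 -> log_dist x <= log_dist y.
Proof.
move=> xy y1; rewrite /log_dist ler_ln ?posrE ?divr_gt0 ?subr_gt0//; last first.
  exact: le_lt_trans y1.
by rewrite !div1r lef_pV2 ?posrE ?subr_gt0 ?lerB// (le_lt_trans xy).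
Qed.

Lemma pair_seq_not_zero_sequence {sigma : R} {a f : R[i] -> R[i]} :
  0 < s -> sigma < s -> analytic_on unit_disc a ->
  (fun r : R => ln (max_modulus r a) : R^o)
    =O_ (1^'-) (fun r : R => log_dist r `^ sigma : R^o) ->
  ode_solution_on unit_disc a f -> ~ zero_sequence_of unit_disc pair_seq f.
Proof.
move=> s0 sigma_s aD /eqO_exP[K K0].
rewrite near_withinE => /nbhs_ballP[d /= d0 aO] ode [_ zf].
(* [sigma] may be negative; [tau] makes the power monotone in its base. The factor [3 ^ tau] comes
   from [log_dist x <= 3 (k + 1)] on the segment. *)
pose tau := Num.max sigma 0; pose p := s - tau; pose K' := K * 3 `^ tau.
have p0 : 0 < p by rewrite subr_gt0 gt_max sigma_s.
have tau0 : 0 <= tau by rewrite le_max lexx orbT.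
(* The first condition puts the segment where the O-bound holds; the second lets [(k + 1) ^ s]
   dominate [K' (k + 1) ^ tau]. Any [k + 1] above [K' ^ (1 / p) + 1 / d] meets both. *)
have [k [kd kK]] : exists k, depth k < d /\ K' <= k.+1%:R `^ p.
  have K'0 : 0 <= K' by rewrite mulr_ge0 ?powR_ge0 ?ltW.
  pose k := Num.Def.archi_bound (K' `^ p^-1 + d^-1).
  have kx : K' `^ p^-1 + d^-1 <= k.+1%:R.
    apply: le_trans (ltW (archi_boundP _)) _; last by rewrite ler_nat.
    by rewrite addr_ge0 ?powR_ge0 ?invr_ge0 ?ltW.
  have dV : 0 < d^-1 by rewrite invr_gt0.
  have KV : 0 <= K' `^ p^-1 by exact: powR_ge0.
  exists k; split.
    rewrite /depth expRN -[ltRHS]invrK ltf_pV2 ?posrE ?expR_gt0//.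
    by have := expR_ge1Dx (2 * k.+1%:R : R); lra.
  have -> : K' = (K' `^ p^-1) `^ p by rewrite -powRrM mulVf ?lt0r_neq0// powRr1.
  by rewrite ge0_ler_powR ?nnegrE ?powR_ge0 ?(ltW p0)//; lra.
have m1 : 1 <= k.+1%:R :> R by rewrite ler1n.
have e2 : k.*2./2 = k by exact: (half_bit_double k false).
have o2 : k.*2.+1./2 = k by exact: (half_bit_double k true).
have he : height k.*2 = depth k by rewrite /height odd_double e2 subr0.
have ho : height k.*2.+1 = depth k - gap k.
  by rewrite /height oddS odd_double o2.
have [g0 dk] := (gap_gt0 k, depth_gt0 k).
have zero n : f (pair_seq n) = 0.
  have : range pair_seq (pair_seq n) by exists n.
  by rewrite -zf => -[].
have fe : f (1 - depth k)%:C = 0 by have := zero k.*2; rewrite /pair_seq he.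
have fo : f (1 - (depth k - gap k))%:C = 0.
  by have := zero k.*2.+1; rewrite /pair_seq ho.
have /andP[+ _] := log_dist_bounds k.*2; rewrite e2 he => Le.
have /andP[_ +] := log_dist_bounds k.*2.+1; rewrite o2 ho => Lo.
(* With both [he] and [ho] in the context, [lra] compares [height k.*2] and
   [height k.*2.+1] by conversion, which does not terminate in practice. *)
clear ho; have gd := gap_le k; have d1 := depth_le_third k.
have aM x : x \in `[1 - depth k, 1 - (depth k - gap k)] ->
    cmod (a x%:C) <= expR (K' * k.+1%:R `^ tau).
  rewrite in_itv/= => /andP[xe xo].
  have x1 : x < 1 by lra.
  have x0 : 0 <= x by lra.
  (* The lower bound 1 is what allows the exponent [sigma] to be raised to [tau]. *)
  have Lx : 1 <= log_dist x <= 3 * k.+1%:R.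
    have xLe := log_dist_le _ _ xe x1.
    have o1 : 1 - (depth k - gap k) < 1 by lra.
    have xLo := log_dist_le _ _ xo o1.
    apply/andP; split; first by apply: le_trans xLe; apply: le_trans Le; lra.
    by apply: (le_trans xLo); apply: (le_trans Lo); lra.
  have /andP[L1 L3] := Lx.
  have := cmod_le_max_modulus x%:C aD; rewrite /unit_disc /mkset cmod_real.
  rewrite ger0_norm// => /(_ x1) /le_trans; apply.
  (* The logarithm can be inverted only at positive arguments. *)
  have [M0|M0] := leP (max_modulus x a) 0.
    exact: le_trans M0 (expR_ge0 _).
  rewrite -[leLHS]lnK ?posrE// ler_expR.
  have xd : ball (1 : R) d x by rewrite -ball_normE /= ger0_norm; lra.
  apply: le_trans (le_trans (ler_norm _) (aO x xd x1)) _.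
  rewrite ger0_norm ?powR_ge0// /K' -mulrA ler_pM2l// -powRM//.
  apply: (@le_trans _ _ (log_dist x `^ tau)).
    by rewrite ler_powR// le_max lexx.
  by rewrite ge0_ler_powR ?nnegrE//; lra.
(* The exponents add up to [K' (k + 1) ^ tau - 2 (k + 1) ^ s], which is nonpositive by [kK]; what
   remains is the square of [depth k / 8]. *)
have small : expR (K' * k.+1%:R `^ tau) *
    (1 - (depth k - gap k) - (1 - depth k)) ^+ 2 < 2^-1.
  rewrite (_ : 1 - _ - _ = gap k); last by lra.
  rewrite /gap exprMn mulrCA expr2 -[expR (- _) ^+ 2]expRM_natl -expRD.
  apply: (@le_lt_trans _ _ (depth k / 8 * (depth k / 8) * 1)).
    rewrite ler_pM2l ?mulr_gt0 ?divr_gt0// -[leRHS]expR0 ler_expR.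
    have -> : s = p + tau by rewrite subrK.
    rewrite powRD; last by rewrite implybE; apply/orP; right; lra.
    have := ler_wpM2r (powR_ge0 k.+1%:R tau) kK.
    have : 0 <= k.+1%:R `^ p * k.+1%:R `^ tau by rewrite mulr_ge0 ?powR_ge0.
    by clear; lra.
  by have := depth_le_third k; nra.
(* The midpoint of the pair is a zero of [f], hence a member of the sequence. Its distance
   [gap k / 2] from the member of index [2 k] is impossible: other members of the sequence lie at
   distance at least [gap k]. *)
pose x := 1 - (depth k - gap k / 2).
have fx : f x%:C = 0.
  apply: (ode_solution_eq0_between _ _ _ _ _ ode _ _ _ fe fo aM small).
  - by lra.
  - by lra.
  - by lra.
  - by rewrite in_itv/= /x; apply/andP; split; lra.
have [n _ nx] : range pair_seq x%:C.
  rewrite -zf; split=> //; rewrite /unit_disc /mkset cmod_real /x.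
  by rewrite ger0_norm; lra.
have hn : height n = depth k - gap k / 2.
  by move: nx => /complexI /(congr1 (fun y => 1 - y)); rewrite !subKr.
have dist : `|height n - height k.*2| = gap k / 2.
  by rewrite hn he addrAC subrr add0r normrN gtr0_norm ?divr_gt0.
have [nk|/eqP /height_far] := eqVneq n./2 k.*2./2; last first.
  move=> /(lt_trans (gap_lt_height k.*2)); rewrite dist e2.
  by clear -g0; lra.
have [nn|/eqP nn] := eqVneq n k.*2.
  by move: dist; rewrite nn subrr normr0; clear -g0; lra.
by have := height_partner _ _ nk nn; rewrite dist e2; clear -g0; lra.
Qed.

End Pairs.

Theorem theorem4 (R : realType) (eta1 eta2 : R) (eta1_gt0 : 0 < eta1)
    (eta2_gt0 : 0 < eta2) :
  exists z : nat -> R[i],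
    [/\ (forall k, unit_disc (z k)) /\ injective z,
        exists2 C : R, 0 < C & forall k : nat,
          (npoints z (z k) ((1 - cmod (z k)) / 2)
             <= (C * log_dist (cmod (z k)) `^ eta1)%:E)%E,
        exists2 C : R, 0 < C & forall k : nat,
          (Npoints z (z k) ((1 - cmod (z k)) / 2)
             <= (C * log_dist (cmod (z k)) `^ (1 + eta1 + eta2))%:E)%E
      & forall eta : R, eta < eta2 ->
          ~ exists a f : R[i] -> R[i],
              [/\ analytic_on unit_disc a,
                  (fun r : R => ln (max_modulus r a) : R^o)
                    =O_ (1^'-) (fun r : R => log_dist r `^ (1 + eta) : R^o),
                  ode_solution_on unit_disc a f
                & zero_sequence_of unit_disc z f]].
Proof.
pose s := 1 + eta2; exists (pair_seq s).
have s0 : 0 < s by rewrite /s; lra.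
(* With base at least 1, powers of [log_dist] increase with the exponent, so the estimates below
   hold for every [k] without exceptions near the origin. *)
have L k : 1 <= (k./2.+1%:R : R) <= log_dist (1 - height s k).
  have /andP[+ _] := log_dist_bounds s k.
  have : 1 <= k./2.+1%:R :> R by rewrite ler1n.
  by move=> *; apply/andP; split; lra.
split.
- split; last exact: pair_seq_inj.
  by move=> k; rewrite /unit_disc /mkset cmod_pair_seq ltrBlDr ltrDl height_gt0.
- exists 2 => // k; rewrite cmod_pair_seq subKr.
  rewrite npoints_ge_gap ?lexx//; last first.
    exact/ltW/gap_lt_height.
  rewrite lee_fin ler_pMr//; have /andP[k1 /(le_trans k1) L1] := L k.
  by apply: powR_ge1 => //; exact: ltW.
(* The construction achieves the exponent [s = 1 + eta2]; [eta1] only adds slack. *)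
- exists 4 => // k; rewrite cmod_pair_seq subKr.
  apply: le_trans (Npoints_pair_seq_le _ _ (ltW s0)) _.
  have /andP[k1 kL] := L k; have L1 := le_trans k1 kL.
  rewrite lee_fin ler_pM2l//.
  apply: (@le_trans _ _ (log_dist (1 - height s k) `^ s)).
    by rewrite ge0_ler_powR ?nnegrE ?(ltW s0)//; lra.
  by rewrite ler_powR// /s; lra.
- move=> eta eta_lt [a [f [aD aO ode]]].
  by apply: (pair_seq_not_zero_sequence s s0 _ aD aO ode); rewrite ltrD2l.
Qed.
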